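(* Let $(M^4,g)$ be a complete oriented Ricci-flat ALE Riemannian 4-manifold, let $c>0$ and $\Delta_L=\nabla^*\nabla+c\,\mathfrak{Ric}$. Let $W^\pm$ denote either the self-dual part $W^+$ or the anti-self-dual part $W^-$ of the Weyl tensor, and suppose that this part satisfies $$\Delta_LW^\pm=0\quad\text{and}\quad|W^\pm|\in L^Q(M)\ \text{ for some }Q>1.$$ Assume further that the curvature operator of $(M,g)$ is $1$-nonnegative. Then $W^\pm\equiv0$ and $(M,g)$ is flat.
   Context: ALE (asymptotically locally Euclidean): there are a compact set $C\subset M$, a finite group $\Gamma\subset O(n)$ acting freely on $S^{n-1}$ and a diffeomorphism $M\setminus C\cong(\mathbb R^n\setminus \overline{B})/\Gamma$ ($\overline B$ a closed ball) in which $g_{ij}=\delta_{ij}+O(r^{-\tau})$ for some $\tau>0$, with $\partial^kg_{ij}=O(r^{-\tau-k})$ for the derivatives. Curvature operator: $\mathfrak R:\Lambda^2TM\to\Lambda^2TM$ is the self-adjoint operator $g(\mathfrak R(X\wedge Y),Z\wedge W)=\mathrm{Rm}(X,Y,Z,W)$, with sign convention such that it equals $K\cdot\mathrm{id}$ on a space of constant curvature $K$ ($\{e_i\wedge e_j\}_{i<j}$ being orthonormal for orthonormal $\{e_i\}$). It is $1$-nonnegative if its lowest eigenvalue is $\ge0$ at every point. Action on tensors: $\Lambda^2T_xM$ is identified with $\mathfrak{so}(T_xM)$, and $L\in\mathfrak{so}(T_xM)$ acts on $(0,k)$-tensors by $(LT)(X_1,\dots,X_k)=-\sum_iT(X_1,\dots,LX_i,\dots,X_k)$.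 For an orthonormal basis $\{\Xi_\alpha\}$ of $\mathfrak{so}(T_xM)\cong\Lambda^2T_xM$, $\mathfrak{Ric}(T)=-\sum_\alpha\mathfrak R(\Xi_\alpha)(\Xi_\alpha T)$. $\nabla^*$ is the formal adjoint of $\nabla$, so $\nabla^*\nabla=-\mathrm{tr}\,\nabla^2$. The tensors $W^\pm$ are regarded as $(0,4)$-tensors. *)

(* Defs.v *)
(* Chart-based Riemannian geometry.  Tensor fields are given by their components
   in every chart of an atlas; R^n is 'rV[R]_n, whose library norm is the sup
   norm (irrelevant here beyond its topology), and the coordinate vector fields
   are indexed by 'I_n. *)
From HB Require Import structures.
From mathcomp Require Import all_boot all_order all_algebra.
From mathcomp Require Import all_classical all_reals all_analysis.

Set Implicit Arguments.
Unset Strict Implicit.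
Unset Printing Implicit Defensive.

Import Order.TTheory GRing.Theory Num.Theory.
Import numFieldNormedType.Exports.

Local Open Scope classical_set_scope.
Local Open Scope ring_scope.

Section Calculus.
Context {R : realType} {n : nat}.
Implicit Types (f : 'rV[R]_n -> R) (U : set 'rV[R]_n).

Definition partial (i : 'I_n) f : 'rV[R]_n -> R :=
  fun x => 'D_(delta_mx 0 i) f x.

Definition partials (s : seq 'I_n) f : 'rV[R]_n -> R := foldr partial f s.

(* C^oo: all iterated partial derivatives exist and are continuous on U.
   Meaningful for open U; the values of f outside U are irrelevant. *)
Definition smooth_on U f : Prop :=
  forall s x, U x ->
    {for x, continuous (partials s f)} /\
    forall i, derivable (partials s f) x (delta_mx 0 i).

Definition smooth_map_on m U (F : 'rV[R]_n -> 'rV[R]_m) : Prop :=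
  forall j, smooth_on U (fun x => F x 0 j).

Definition enorm (x : 'rV[R]_n) : R := Num.sqrt (\sum_i x 0 i ^+ 2).

End Calculus.

(* Lebesgue integral over R^n of a nonnegative Borel function, as an iterated
   integral (Tonelli). *)
Fixpoint iterated_integral (R : realType) (n : nat) :
    ('rV[R]_n -> \bar R) -> \bar R :=
  match n return ('rV[R]_n -> \bar R) -> \bar R with
  | 0 => fun f => f 0
  | m.+1 => fun f => (\int[@lebesgue_measure R]_t
      iterated_integral (fun v : 'rV[R]_m => f (row_mx t%:M v)))%E
  end.

Record chart (R : realType) (n : nat) (M : topologicalType) := Chart {
  dom : set M;
  coord : M -> 'rV[R]_n;
  param : 'rV[R]_n -> M;
  dom_open : open dom;
  img_open : open (coord @` dom);
  coord_continuous : {within dom, continuous coord};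
  param_continuous : {within coord @` dom, continuous param};
  coordK : forall p, dom p -> param (coord p) = p
}.

Definition img (R : realType) n M (a : chart R n M) : set 'rV[R]_n :=
  coord a @` dom a.

Definition overlap (R : realType) n M (a b : chart R n M) : set 'rV[R]_n :=
  coord a @` (dom a `&` dom b).

Definition transition (R : realType) n M (a b : chart R n M) :
    'rV[R]_n -> 'rV[R]_n :=
  coord b \o param a.

Record smooth_manifold (R : realType) (n : nat) := SmoothManifold {
  carrier :> topologicalType;
  carrier_hausdorff : hausdorff_space carrier;
  carrier_second_countable : @second_countable carrier;
  chart_index : Type;
  atlas : chart_index -> chart R n carrier;
  chart_at : carrier -> chart_index;
  chart_at_dom : forall p, dom (atlas (chart_at p)) p;
  atlas_smooth : forall a b,
    smooth_map_on (overlap (atlas a) (atlas b)) (transition (atlas a) (atlas b))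
}.

(* The orientation is the one for which all charts of the atlas are positively
   oriented.  Here jacobian F x i j = d_i F_j (row-vector convention). *)
Definition oriented (R : realType) n (M : smooth_manifold R n) : Prop :=
  forall (a b : chart_index M) x, overlap (atlas a) (atlas b) x ->
    0 < \det (jacobian (transition (atlas a) (atlas b)) x).

Record riemannian_metric (R : realType) n (M : smooth_manifold R n) :=
    RiemannianMetric {
  gram : chart_index M -> 'rV[R]_n -> 'M[R]_n;
  gram_smooth : forall a i j,
    smooth_on (img (atlas a)) (fun x => gram a x i j);
  gram_sym : forall a x, img (atlas a) x -> (gram a x)^T = gram a x;
  gram_posdef : forall a x, img (atlas a) x ->
    forall v : 'rV[R]_n, v != 0 -> 0 < (v *m gram a x *m v^T) 0 0;
  gram_transition : forall a b x, overlap (atlas a) (atlas b) x ->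
    let F := transition (atlas a) (atlas b) in
    gram a x = jacobian F x *m gram b (F x) *m (jacobian F x)^T
}.

(* Components T_I of a (0,k)-tensor at a point. *)
Definition tensor (R : realType) (n k : nat) := ('I_k -> 'I_n) -> R.

(* G is the Gram matrix (g_ij) of the metric as a function of the coordinates
   of a chart, and x the coordinates of a point. *)
Section LocalGeometry.
Context {R : realType} {n : nat}.
Implicit Types (G : 'rV[R]_n -> 'M[R]_n) (x : 'rV[R]_n) (xi eta : 'M[R]_n).

Definition index_cons k (a : 'I_n) (I : 'I_k -> 'I_n) : 'I_k.+1 -> 'I_n :=
  fun j => if unlift ord0 j is Some j' then I j' else a.

Definition index_set k (I : 'I_k -> 'I_n) (l : 'I_k) (m : 'I_n) :
    'I_k -> 'I_n :=
  fun j => if j == l then m else I j.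

Definition index4 (i j k l : 'I_n) : 'I_4 -> 'I_n :=
  fun a => nth i [:: i; j; k; l] a.

Definition ginv G x : 'M[R]_n := invmx (G x).

(* christoffel G x k i j = Gamma^k_ij *)
Definition christoffel G x (k i j : 'I_n) : R :=
  2^-1 * \sum_l ginv G x k l *
    (partial i (fun y => G y j l) x + partial j (fun y => G y i l) x
     - partial l (fun y => G y i j) x).

(* The d_l-component of R(d_i, d_j) d_k, where
   R(X,Y)Z = nabla_X nabla_Y Z - nabla_Y nabla_X Z - nabla_[X,Y] Z. *)
Definition riem_endo G x (i j k l : 'I_n) : R :=
  partial i (fun y => christoffel G y l j k) x
  - partial j (fun y => christoffel G y l i k) x
  + \sum_m (christoffel G x m j k * christoffel G x l i m
            - christoffel G x m i k * christoffel G x l j m).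

(* Rm(X,Y,Z,W) = g(R(X,Y)W, Z), so that in constant curvature K
   Rm(X,Y,Z,W) = K (g(X,Z) g(Y,W) - g(X,W) g(Y,Z)). *)
Definition Rm G x (i j k l : 'I_n) : R :=
  \sum_m G x k m * riem_endo G x i j l m.

Definition Ric G x (j l : 'I_n) : R :=
  \sum_i \sum_k ginv G x i k * Rm G x i j k l.

Definition scal G x : R := \sum_j \sum_l ginv G x j l * Ric G x j l.

(* For n >= 3. *)
Definition Weyl G x (i j k l : 'I_n) : R :=
  let g := G x in
  Rm G x i j k l
  - (n%:R - 2)^-1 *
      (Ric G x i k * g j l - Ric G x i l * g j k
       + g i k * Ric G x j l - g i l * Ric G x j k)
  + scal G x / ((n%:R - 1) * (n%:R - 2)) * (g i k * g j l - g i l * g j k).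

(* A bivector (1/2) xi^ij d_i /\ d_j is its antisymmetric matrix (xi^ij); thus
   X /\ Y has matrix X^i Y^j - X^j Y^i, and e_i /\ e_j (i < j) are orthonormal
   for orthonormal e_i. *)
Definition is_bivector xi : Prop := xi^T = - xi.

Definition bivector_inner G x xi eta : R :=
  2^-1 * \sum_i \sum_j \sum_k \sum_l
    G x i k * G x j l * xi i j * eta k l.

(* The operator with g(curvature_operator (X /\ Y), Z /\ W) = Rm(X,Y,Z,W). *)
Definition curvature_operator G x xi : 'M[R]_n :=
  \matrix_(k, l) (2^-1 * \sum_i \sum_j \sum_a \sum_b
    ginv G x k a * ginv G x l b * Rm G x i j a b * xi i j).

(* Lambda^2 = so(T_x M): X /\ Y acts by Z |-> g(X,Z) Y - g(Y,Z) X; entry (a, b)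
   is the d_a-component of the image of d_b.  The opposite sign convention
   yields the same Ric_action below. *)
Definition so_of_bivector G x xi : 'M[R]_n := - (xi *m G x).

Definition so_action k (L : 'M[R]_n) (T : tensor R n k) : tensor R n k :=
  fun I => - \sum_l \sum_m L m (I l) * T (index_set I l m).

Definition bivector_onb G x (Xi : 'I_('C(n, 2)) -> 'M[R]_n) : Prop :=
  (forall p, is_bivector (Xi p)) /\
  (forall p q, bivector_inner G x (Xi p) (Xi q) = (p == q)%:R).

Definition some_bivector_onb G x : 'I_('C(n, 2)) -> 'M[R]_n :=
  xget (fun _ => 0) (bivector_onb G x).

(* The value does not depend on the chosen orthonormal basis. *)
Definition Ric_action k G x (T : tensor R n k) : tensor R n k :=
  let Xi := some_bivector_onb G x in
  fun I => - \sum_p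
    so_action (so_of_bivector G x (curvature_operator G x (Xi p)))
      (so_action (so_of_bivector G x (Xi p)) T) I.

(* (nabla T)(d_a, d_I) = (nabla_{d_a} T)(d_I): the new slot comes first. *)
Definition cov_deriv k G (T : 'rV[R]_n -> tensor R n k) :
    'rV[R]_n -> tensor R n k.+1 :=
  fun x aI =>
    let a := aI ord0 in
    let I := fun j => aI (lift ord0 j) in
    partial a (fun y => T y I) x
    - \sum_l \sum_m christoffel G x m a (I l) * T x (index_set I l m).

Definition rough_laplacian k G (T : 'rV[R]_n -> tensor R n k) :
    'rV[R]_n -> tensor R n k :=
  fun x I => - \sum_a \sum_b ginv G x a b *
    cov_deriv G (cov_deriv G T) x (index_cons a (index_cons b I)).

Definition lichnerowicz k (c : R) G (T : 'rV[R]_n -> tensor R n k) :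
    'rV[R]_n -> tensor R n k :=
  fun x I => rough_laplacian G T x I + c * Ric_action G x (T x) I.

Definition tensor_normsq k G x (T : tensor R n k) : R :=
  \sum_(I : {ffun 'I_k -> 'I_n}) \sum_(J : {ffun 'I_k -> 'I_n})
    (\prod_l ginv G x (I l) (J l)) * T I * T J.

End LocalGeometry.

Section Dimension4.
Context {R : realType}.
Implicit Types (G : 'rV[R]_4 -> 'M[R]_4) (x : 'rV[R]_4).

(* Riemannian volume form in a positively oriented chart; the determinant is
   the Levi-Civita symbol. *)
Definition volume_form G x (i j k l : 'I_4) : R :=
  Num.sqrt (\det (G x)) *
  \det (\matrix_(a, b) ((index4 i j k l a == b)%:R : R)).

(* Hodge star on 2-forms: w /\ * w = |w|^2 vol. *)
Definition hodge_star G x (w : 'I_4 -> 'I_4 -> R) (i j : 'I_4) : R :=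
  2^-1 * \sum_p \sum_q \sum_p' \sum_q'
    ginv G x p p' * ginv G x q q' * w p q * volume_form G x p' q' i j.

(* W^+ (s = false) and W^- (s = true): (W + *W)/2 and (W - *W)/2 with the star
   acting on the first pair of slots (on W it agrees with the second pair). *)
Definition Weyl_part (s : bool) G x : tensor R 4 4 :=
  fun I => 2^-1 *
    (Weyl G x (I 0) (I 1) (I 2) (I 3)
     + (-1) ^+ s *
       hodge_star G x (fun p q => Weyl G x p q (I 2) (I 3)) (I 0) (I 1)).

End Dimension4.

Section Global.
Context {R : realType} {n : nat} {M : smooth_manifold R n}.
Implicit Types (g : riemannian_metric M).

(* Components in each chart; only their values on the image of the chart
   matter. *)
Definition tensor_field k := chart_index M -> 'rV[R]_n -> tensor R n k.

Definition vanishes k (T : tensor_field k) : Prop :=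
  forall a x, img (atlas a) x -> forall I, T a x I = 0.

Definition flat g : Prop :=
  forall a x, img (atlas a) x -> forall i j k l, Rm (gram g a) x i j k l = 0.

Definition ricci_flat g : Prop :=
  forall a x, img (atlas a) x -> forall j l, Ric (gram g a) x j l = 0.

(* 1-nonnegativity: the lowest eigenvalue, i.e. every eigenvalue, is >= 0. *)
Definition curvature_operator_1nonneg g : Prop :=
  forall a x, img (atlas a) x ->
    forall (lambda : R) (xi : 'M[R]_n), is_bivector xi -> xi != 0 ->
      curvature_operator (gram g a) x xi = lambda *: xi -> 0 <= lambda.

Definition geodesic g (gamma : R -> M) : Prop :=
  continuous gamma /\
  forall (a : chart_index M) t, dom (atlas a) (gamma t) ->
    let u := fun k s => coord (atlas a) (gamma s) 0 k in
    forall k, [/\ derivable (u k) t 1, derivable (derive1 (u k)) t 1 &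
      derive1 (derive1 (u k)) t
      + \sum_i \sum_j christoffel (gram g a) (coord (atlas a) (gamma t)) k i j
          * derive1 (u i) t * derive1 (u j) t = 0].

(* Geodesic completeness: exp_p is defined on all of T_p M for every p. *)
Definition complete g : Prop :=
  forall a p (v : 'rV[R]_n), dom (atlas a) p ->
    exists gamma : R -> M, [/\ geodesic g gamma, gamma 0 = p &
      forall k, derive1 (fun s => coord (atlas a) (gamma s) 0 k) 0 = v 0 k].

(* Integral of a nonnegative Borel function f against the Riemannian volume:
   supremum, over finite families of disjoint Borel sets each lying in a chart,
   of the sums of the integrals of f sqrt(det g) in coordinates. *)
Definition riemannian_integral g (f : M -> R) : \bar R :=
  ereal_sup [set S | exists (m : nat) (a : 'I_m -> chart_index M)
                            (A : 'I_m -> set M),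
    [/\ forall k, <<s @open M >> (A k),
        forall k, A k `<=` dom (atlas (a k)),
        trivIset setT A &
        S = (\sum_(k < m) iterated_integral (fun y =>
          (f (param (atlas (a k)) y) * Num.sqrt (\det (gram g (a k) y))
           * \1_(coord (atlas (a k)) @` A k) y)%:E))%E]].

Definition tensor_norm k g (T : tensor_field k) : M -> R := fun p =>
  let a := chart_at p in
  let x := coord (atlas a) p in
  Num.sqrt (tensor_normsq (gram g a) x (T a x)).

(* u in L^Q(M) for a continuous function u and 1 <= Q < oo *)
Definition in_LQ g (Q : R) (u : M -> R) : Prop :=
  (riemannian_integral g (fun p => (`|u p| `^ Q)%R) < +oo)%E.

(* A finite subgroup of O(n) acting freely on the unit sphere. *)
Record free_orthogonal_group (Gam : set 'M[R]_n) : Prop := {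
  fog_finite : finite_set Gam;
  fog_orthogonal : forall A, Gam A -> A *m A^T = 1%:M;
  fog_one : Gam 1%:M;
  fog_mul : forall A B, Gam A -> Gam B -> Gam (A *m B);
  fog_inv : forall A, Gam A -> Gam (invmx A);
  fog_free : forall A, Gam A -> A != 1%:M ->
    forall v : 'rV[R]_n, enorm v = 1 -> v *m A^T != v
}.

(* A diffeomorphism (R^n \ closed ball)/Gam -> M \ C is given by its composite
   Phi with the quotient map: a local diffeomorphism from R^n \ closed ball onto
   M \ C whose fibres are the Gam-orbits; h is the metric Phi^* g.  A in Gam
   acts on row vectors by v |-> v *m A^T = (A v^T)^T. *)
Record ALE_end g (C : set M) (Gam : set 'M[R]_n) (rho tau : R)
    (Phi : 'rV[R]_n -> M) (h : 'rV[R]_n -> 'M[R]_n) : Prop := {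
  ale_compact : compact C;
  ale_group : free_orthogonal_group Gam;
  ale_rho : 0 < rho;
  ale_tau : 0 < tau;
  ale_onto : Phi @` [set x | rho < enorm x] = ~` C;
  ale_fibre : forall x y, rho < enorm x -> rho < enorm y ->
    (Phi x = Phi y <-> exists2 A, Gam A & y = x *m A^T);
  ale_open : forall a,
    open ([set x | rho < enorm x] `&` Phi @^-1` dom (atlas a));
  ale_smooth : forall a,
    smooth_map_on ([set x | rho < enorm x] `&` Phi @^-1` dom (atlas a))
      (coord (atlas a) \o Phi);
  ale_etale : forall a x, rho < enorm x -> dom (atlas a) (Phi x) ->
    jacobian (coord (atlas a) \o Phi) x \in unitmx;
  ale_pullback : forall a x, rho < enorm x -> dom (atlas a) (Phi x) ->
    let J := jacobian (coord (atlas a) \o Phi) x in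
    h x = J *m gram g a (coord (atlas a) (Phi x)) *m J^T;
  ale_decay : forall s : seq 'I_n, exists K r0 : R,
    forall x, rho < enorm x -> r0 <= enorm x -> forall i j,
      `|partials s (fun y => h y i j - (i == j)%:R) x|
        <= K * enorm x `^ (- (tau + (size s)%:R))
}.

Definition ALE g : Prop :=
  exists C Gam rho tau Phi h, @ALE_end g C Gam rho tau Phi h.

End Global.

Arguments tensor_field {R n} M k.

(* Main.v *)
(* The theorem is pointwise linear algebra.  The second partial derivatives of
   the metric commute, so Rm has its usual symmetries and the curvature operator
   is self-adjoint; 1-nonnegativity then makes its quadratic form nonnegative.
   Ric(e, e) is the sum of the values of this form on the bivectors e_m /\ e for
   an orthonormal basis (e_m), so Ricci-flatness makes each of them vanish.  An
   isotropic vector of a nonnegative form lies in its kernel, hence Rm = 0 and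
   W = 0. *)
Require Import Defs.
From HB Require Import structures.
From mathcomp Require Import all_boot all_order all_algebra.
From mathcomp Require Import all_classical all_reals all_analysis.
From mathcomp Require Import ring lra.

Set Implicit Arguments.
Unset Strict Implicit.
Unset Printing Implicit Defensive.

Import Order.TTheory GRing.Theory Num.Theory.
Import numFieldNormedType.Exports.

Local Open Scope classical_set_scope.
Local Open Scope ring_scope.

(** * Positive definite and semidefinite quadratic forms *)

Definition posdef (R : numDomainType) n (A : 'M[R]_n) : Prop :=
  forall v : 'rV[R]_n, v != 0 -> 0 < (v *m A *m v^T) 0 0.

(** Block elimination, by induction on the size: the Schur complement [D - a^-1 *: (b^T *m b)] of
    the corner entry [a] is again symmetric and positive definite, and its factor completes a block
    lower triangular factor of [G]. *)
Lemma cholesky (R : rcfType) n (G : 'M[R]_n) :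
  G^T = G -> posdef G -> exists P : 'M[R]_n, G = P *m P^T.
Proof.
elim: n G => [|n IHn] G symG posG.
  by exists 0; rewrite [LHS]flatmx0 [RHS]flatmx0.
change ('M[R]_(1 + n)) in G.
pose a := ulsubmx G 0 0; pose b : 'rV_n := ursubmx G; pose D := drsubmx G.
have Gblock : G = block_mx a%:M b b^T D.
  have -> : b^T = dlsubmx G by rewrite /b trmx_ursub symG.
  by rewrite /a -mx11_scalar submxK.
have symD : D^T = D by rewrite /D trmx_drsub symG.
have quadG u w : (row_mx u%:M w *m G *m (row_mx u%:M w)^T) 0 0
    = u ^+ 2 * a + 2 * u * (w *m b^T) 0 0 + (w *m D *m w^T) 0 0.
  rewrite Gblock mul_row_block tr_row_mx mul_row_col.
  rewrite !mulmxDl tr_scalar_mx !mul_scalar_mx !mul_mx_scalar.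
  rewrite -!scalemxAl.
  have -> : b *m w^T = (w *m b^T)^T by rewrite trmx_mul trmxK.
  set p := w *m b^T; set q := w *m D *m w^T.
  rewrite !mxE eqxx mulr1n; ring.
have a_gt0 : 0 < a.
  have := posG (row_mx 1%:M 0); rewrite quadG !mul0mx !mxE.
  rewrite expr1n mul1r mulr0 !addr0; apply.
  apply/eqP => /(congr1 (fun x : 'rV[R]_(1 + n) => x 0 (lshift n 0))) /eqP.
  by rewrite row_mxEl !mxE oner_eq0.
have a_neq0 : a != 0 by rewrite gt_eqF.
have [||P defP] := IHn (D - a^-1 *: (b^T *m b)).
- by rewrite linearB linearZ /= trmx_mul trmxK symD.
- move=> w w_neq0.
  (* For fixed [w], this first coordinate minimizes the form, and the minimum is the Schur
     complement evaluated at [w]. *)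
  have := posG (row_mx (- a^-1 * (w *m b^T) 0 0)%:M w); rewrite quadG.
  suff -> : (w *m (D - a^-1 *: (b^T *m b)) *m w^T) 0 0
      = (w *m D *m w^T) 0 0 - a^-1 * (w *m b^T) 0 0 ^+ 2.
    set p := (w *m b^T) 0 0; set d := (w *m D *m w^T) 0 0 => pos_pd.
    have -> : d - a^-1 * p ^+ 2
        = (- a^-1 * p) ^+ 2 * a + 2 * (- a^-1 * p) * p + d by field.
    apply: pos_pd; apply: contra_neq w_neq0 => row0.
    by rewrite -[w](row_mxKr (- a^-1 * (w *m b^T) 0 0)%:M) row0 linear0.
  rewrite mulmxBr mulmxBl mxE [X in _ + X]mxE -scalemxAr -scalemxAl.
  rewrite [X in _ - X]mxE.
  have -> : w *m (b^T *m b) *m w^T = (w *m b^T) *m (w *m b^T)^T.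
    by rewrite trmx_mul trmxK !mulmxA.
  rewrite [w *m b^T]mx11_scalar tr_scalar_mx -scalar_mxM expr2.
  have scalar11 (r : R) : r%:M (0 : 'I_1) (0 : 'I_1) = r by rewrite mxE eqxx.
  by rewrite !scalar11.
pose Q : 'M[R]_(1 + n) :=
  block_mx (Num.sqrt a)%:M 0 ((Num.sqrt a)^-1 *: b^T) P.
suff GQ : G = Q *m Q^T by exists Q.
have sqrt_neq0 : Num.sqrt a != 0 by rewrite gt_eqF ?sqrtr_gt0.
rewrite Gblock /Q tr_block_mx mulmx_block !trmx0 !tr_scalar_mx !mul0mx !mulmx0.
rewrite !addr0 -scalar_mxM -expr2 sqr_sqrtr ?ltW // -defP.
rewrite linearZ /= trmxK mul_scalar_mx mul_mx_scalar !scalerA divff //.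
rewrite !scale1r -scalemxAl -scalemxAr scalerA -invfM -expr2 sqr_sqrtr ?ltW //.
by rewrite addrC subrK.
Qed.

Lemma mulmx_trmx_row_eq0 (R : realDomainType) n (u : 'rV[R]_n) :
  ((u *m u^T) 0 0 == 0) = (u == 0).
Proof.
apply/eqP/eqP => [|->]; last by rewrite mul0mx mxE.
rewrite mxE => /eqP; rewrite psumr_eq0 => [/allP u0|i _]; last first.
  by rewrite mxE -expr2 sqr_ge0.
apply/rowP => i; have := u0 i (mem_index_enum _).
by rewrite !mxE -expr2 sqrf_eq0 => /eqP.
Qed.

Lemma mulmx_trmx_row_ge0 (R : realDomainType) n (u : 'rV[R]_n) :
  0 <= (u *m u^T) 0 0.
Proof. by rewrite mxE sumr_ge0 // => i _; rewrite mxE -expr2 sqr_ge0. Qed.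

(** Moving from [w] in the direction [u = w *m A], the form has linear coefficient twice the squared
    length of [u]. It would become negative for small negative [t] unless [u = 0]. *)
Lemma psd_isotropic_ker (R : realFieldType) n (A : 'M[R]_n) (w : 'rV[R]_n) :
  A^T = A -> (forall v : 'rV[R]_n, 0 <= (v *m A *m v^T) 0 0) ->
  (w *m A *m w^T) 0 0 = 0 -> w *m A = 0.
Proof.
move=> symA psdA w0; pose u := w *m A; apply/eqP.
rewrite -mulmx_trmx_row_eq0 -/u.
set s := (u *m u^T) 0 0; set q := (u *m A *m u^T) 0 0.
have q_ge0 : 0 <= q by apply: psdA.
(* The denominator [q + 1] is positive even when [q = 0]; the value of the form is then
   [- s ^+ 2 * (q + 2) / (q + 1) ^+ 2], which forces [s = 0]. *)
pose t := - s / (q + 1).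
have : 0 <= 2 * t * s + t ^+ 2 * q.
  have := psdA (w + t *: u); rewrite linearD linearZ /=.
  rewrite mulmxDl mulmxDr !mulmxDl -!scalemxAl -!scalemxAr -/u.
  have -> : u *m A *m w^T = u *m u^T by rewrite -mulmxA -{1}symA -trmx_mul.
  move: w0; rewrite -/u /s /q; set a := u *m w^T; set b := u *m u^T.
  set d := u *m A *m u^T => a0; rewrite mxE [X in X + _]mxE a0.
  by congr (0 <= _); rewrite !mxE; ring.
have -> : 2 * t * s + t ^+ 2 * q = - (s ^+ 2 * ((q + 2) / (q + 1) ^+ 2)).
  by rewrite /t; field; rewrite gt_eqF //; lra.
rewrite oppr_ge0 pmulr_lle0; last first.
  by apply: divr_gt0; rewrite ?exprn_gt0 //; lra.
by rewrite le_eqVlt ltNge sqr_ge0 orbF sqrf_eq0.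
Qed.

Lemma quadratic_form_continuous (R : realType) n (A : 'M[R]_n) :
  continuous (fun v : 'rV[R]_n => (v *m A *m v^T) 0 0).
Proof.
have -> : (fun v : 'rV[R]_n => (v *m A *m v^T) 0 0)
    = (fun v => \sum_j \sum_k v 0 k * A k j * v 0 j).
  apply/funext => v; rewrite mxE; apply: eq_bigr => j _.
  by rewrite !mxE mulr_suml.
apply: continuous_big => [|j _]; first exact: add_continuous.
apply: continuous_big => [|k _ v]; first exact: add_continuous.
apply: (@continuousM _ _ (fun u : 'rV[R]_n => u 0 k * A k j)); last first.
  exact: coord_continuous.
apply: (@continuousM _ _ (fun u : 'rV[R]_n => u 0 k) (cst (A k j))).
  exact: coord_continuous.
exact: cst_continuous.
Qed.

(* A minimizer of the Rayleigh quotient vAv^T / vBv^T is an eigenvector. *)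
Lemma negative_generalized_eigenvalue (R : realType) n (A B : 'M[R]_n)
    (v0 : 'rV[R]_n) :
  A^T = A -> B^T = B -> posdef B -> (v0 *m A *m v0^T) 0 0 < 0 ->
  exists (lambda : R) (w : 'rV[R]_n),
    [/\ lambda < 0, w != 0 & w *m A = lambda *: (w *m B)].
Proof.
move=> symA symB posB neg0.
have v0_neq0 : v0 != 0.
  by apply: contraTneq neg0 => ->; rewrite !mul0mx mxE ltxx.
(* The quotient is homogeneous of degree 0, so its minimum on the compact unit sphere, here that of
   the sup norm, is a minimum over all nonzero vectors. *)
pose S := [set v : 'rV[R]_n | `|v| = 1].
pose f (v : 'rV[R]_n) := (v *m A *m v^T) 0 0 / (v *m B *m v^T) 0 0.
have S_neq0 v : S v -> v != 0.
  apply: contraPneq => ->; rewrite /S /= normr0 => /esym/eqP.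
  by rewrite oner_eq0.
have fZ (t : R) v : t != 0 -> f (t *: v) = f v.
  move=> t_neq0; rewrite /f linearZ /= -!scalemxAl -!scalemxAr !scalerA.
  rewrite [in X in X / _]mxE [in X in _ / X]mxE -mulf_div.
  by rewrite divff ?mul1r ?mulf_neq0.
have S_unit v : v != 0 -> S (`|v|^-1 *: v).
  move=> v_neq0; rewrite /S /= normrZ normfV normr_id mulVf //.
  by rewrite normr_eq0.
have [||| w wS wmin] := @EVT_min_rV R n f S.
- by exists (`|v0|^-1 *: v0); exact: S_unit.
- apply: bounded_closed_compact.
    exists 1; split; first exact: num_real.
    by move=> M M1 v; rewrite /S /= => ->; rewrite ltW.
  have -> : S = (fun v : 'rV[R]_n => `|v|) @^-1` [set 1] by [].
  apply: closed_comp; last exact: closed_eq.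
  by move=> ? _; exact: norm_continuous.
- apply: continuous_in_subspaceT => v /set_mem /S_neq0 v_neq0.
  apply: (@continuousM _ _ (fun u : 'rV[R]_n => (u *m A *m u^T) 0 0)).
    exact: quadratic_form_continuous.
  apply: continuousV; last exact: quadratic_form_continuous.
  by rewrite gt_eqF ?posB.
have {wS} w_neq0 : w != 0 by apply: S_neq0; exact: set_mem.
have fmin v : v != 0 -> f w <= f v.
  move=> v_neq0; rewrite -(fZ `|v|^-1 v) ?invr_eq0 ?normr_eq0 //.
  by apply: wmin; apply/mem_set/S_unit.
exists (f w), w; split => //.
  apply: le_lt_trans (fmin _ v0_neq0) _.
  by rewrite /f pmulr_llt0 // invr_gt0 posB.
(* Minimality makes [A - f w *: B] a nonnegative form that vanishes at [w], so [w] lies in its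
   kernel. *)
apply/eqP; rewrite -subr_eq0 scalemxAr -mulmxBr; apply/eqP.
have formB v : (v *m (A - f w *: B) *m v^T) 0 0
    = (v *m A *m v^T) 0 0 - f w * (v *m B *m v^T) 0 0.
  by rewrite mulmxBr mulmxBl -scalemxAr -scalemxAl !mxE.
apply: psd_isotropic_ker.
- by rewrite linearB linearZ /= symA symB.
- move=> v; have [->|v_neq0] := eqVneq v 0; first by rewrite !mul0mx mxE.
  by rewrite formB subr_ge0 -ler_pdivlMr ?posB // fmin.
- by rewrite formB /f divfK ?subrr // gt_eqF ?posB.
Qed.

(** * Symmetry of mixed second derivatives *)

Lemma derivable_shift (R : numFieldType) (V W : normedModType R) (f : V -> W)
    (a x v : V) :
  derivable (fun y => f (y + a)) x v = derivable f (x + a) v.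
Proof.
by rewrite /derivable; under eq_fun do rewrite /= -addrA.
Qed.

Lemma derive_shiftV (R : numFieldType) (V W : normedModType R) (f : V -> W)
    (a x v : V) :
  'D_v (fun y => f (y + a)) x = 'D_v f (x + a).
Proof.
by rewrite /derive; under eq_fun do rewrite /= -addrA.
Qed.

Lemma MVT_directional (R : realType) (V : normedModType R) (f : V -> R)
    (x v : V) (h : R) :
  0 < h -> (forall t, 0 <= t <= h -> derivable f (x + t *: v) v) ->
  exists2 t, 0 <= t <= h & f (x + h *: v) - f x = h * 'D_v f (x + t *: v).
Proof.
move=> h_gt0 df; pose phi (t : R) := f (x + t *: v).
have quotE (t : R) : (fun r : R => r^-1 *: ((phi \o shift t) (r *: 1) - phi t))
    = (fun r => r^-1 *: ((f \o shift (x + t *: v)) (r *: v) - f (x + t *: v))).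
  apply/funext => r; rewrite /phi /= scalerDl addrCA.
  by rewrite -[r%:A]/(r * 1) mulr1.
have dphi t : 0 <= t <= h -> is_derive t 1 phi ('D_v f (x + t *: v)).
  move=> t_h; apply: DeriveDef; last by rewrite /derive quotE.
  by rewrite /derivable quotE; exact: df.
have [t|| t t_h eqt] := @MVT R phi (fun t => 'D_v f (x + t *: v)) 0 h h_gt0.
- by rewrite in_itv /= => /andP[? ?]; apply: dphi; rewrite !ltW.
- apply: derivable_within_continuous => t; rewrite in_itv /= => t_h.
  by have [] := dphi t t_h.
exists t; first by move: t_h; rewrite in_itv /= => /andP[? ?]; rewrite !ltW.
by move: eqt; rewrite /phi scale0r addr0 subr0 mulrC.
Qed.

(** The mean value theorem is used twice: in direction [u] for the increment [f (y + h *: v) - f y],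
    then in direction [v] for ['D_u f]. *)
Lemma second_difference (R : realType) (V : normedModType R) (f : V -> R)
    (x u v : V) (h : R) :
  0 < h ->
  (forall s t, 0 <= s <= h -> 0 <= t <= h ->
    derivable f (x + s *: u + t *: v) u /\
    derivable ('D_u f) (x + s *: u + t *: v) v) ->
  exists s t, [/\ 0 <= s <= h, 0 <= t <= h &
    f (x + h *: u + h *: v) - f (x + h *: u) - (f (x + h *: v) - f x)
      = h ^+ 2 * 'D_v ('D_u f) (x + s *: u + t *: v)].
Proof.
move=> h_gt0 df.
have h_h : 0 <= h <= h by rewrite lexx ltW.
have o_h : 0 <= (0 : R) <= h by rewrite lexx ltW.
pose f' y := f (y + h *: v).
have df1 s : 0 <= s <= h -> derivable f' (x + s *: u) u.
  by move=> s_h; rewrite derivable_shift; exact: (df s h s_h h_h).1.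
have df2 s : 0 <= s <= h -> derivable f (x + s *: u) u.
  by move=> s_h; have [+ _] := df s 0 s_h o_h; rewrite scale0r addr0.
have [||s s_h] := @MVT_directional R V (f' - f) x u h.
- by [].
- by move=> s s_h; apply: derivableB; [exact: df1|exact: df2].
rewrite deriveB ?derive_shiftV; [|exact: df1|exact: df2].
have [||t t_h ->] := @MVT_directional R V ('D_u f) (x + s *: u) v h.
- by [].
- by move=> t t_h; have [] := df s t s_h t_h.
rewrite mulrA -expr2 => diffE; exists s, t; split => //.
Qed.

(** The second difference is symmetric in [u] and [v], so each mixed derivative takes the same value
    somewhere in a small parallelogram at [x]; continuity at [x] brings the two values at [x] within
    any [e]. *)
Lemma derive_comm (R : realType) (V : normedModType R) (f : V -> R)
    (x u v : V) :
  (\near x, [/\ derivable f x u, derivable f x v,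
     derivable ('D_u f) x v & derivable ('D_v f) x u]) ->
  {for x, continuous ('D_v ('D_u f))} -> {for x, continuous ('D_u ('D_v f))} ->
  'D_v ('D_u f) x = 'D_u ('D_v f) x.
Proof.
have close (e a b z : R) :
    `|a - z| < e / 2 -> `|b - z| < e / 2 -> `|a - b| <= e.
  rewrite [`|b - z|]distrC => az zb; rewrite -(subrKA z).
  by rewrite (le_trans (ler_normD _ _)) // [e]splitr ltW ?ltrD.
move=> df cvu cuv; apply/eqP.
rewrite -subr_eq0 -normr_eq0 eq_le normr_ge0 andbT.
apply/ler_addgt0Pr => e e_gt0; rewrite add0r.
have e2_gt0 : 0 < e / 2 by lra.
pose A := [set y |
    [/\ derivable f y u, derivable f y v,
       derivable ('D_u f) y v & derivable ('D_v f) y u] /\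
    (`|'D_v ('D_u f) x - 'D_v ('D_u f) y| < e / 2 /\
     `|'D_u ('D_v f) x - 'D_u ('D_v f) y| < e / 2)].
have [r r_gt0 near_x] : exists2 r, 0 < r & forall y, `|x - y| < r -> A y.
  move/cvgrPdist_lt/(_ _ e2_gt0): cvu => cvu.
  move/cvgrPdist_lt/(_ _ e2_gt0): cuv => cuv.
  have /nbhs_normP[r /= r_gt0 near_x] : nbhs x A.
    exact: (filterI df (filterI cvu cuv)).
  by exists r => // y /near_x.
(* This side keeps the parallelogram inside the ball of radius [r]; the summand 1 covers
   [u = v = 0]. *)
pose h := r / (`|u| + `|v| + 1).
have d_gt0 : 0 < `|u| + `|v| + 1.
  by have := normr_ge0 u; have := normr_ge0 v; lra.
have h_gt0 : 0 < h by rewrite divr_gt0.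
have in_ball s t : 0 <= s <= h -> 0 <= t <= h ->
    `|x - (x + s *: u + t *: v)| < r.
  move=> /andP[s_ge0 s_h] /andP[t_ge0 t_h].
  rewrite -addrA opprD addNKr normrN (le_lt_trans (ler_normD _ _)) //.
  rewrite !normrZ !ger0_norm // -(divfK (lt0r_neq0 d_gt0) r) -/h.
  rewrite !mulrDr mulr1.
  have := ler_wpM2r (normr_ge0 u) s_h; have := ler_wpM2r (normr_ge0 v) t_h; lra.
have [|s1 [t1 [s1_h t1_h]]] := @second_difference R V f x u v h h_gt0.
  move=> s t s_h t_h.
  have [du dv duv dvu] := (near_x _ (in_ball s t s_h t_h)).1.
  exact: conj du duv.
have [|s2 [t2 [s2_h t2_h]]] := @second_difference R V f x v u h h_gt0.
  move=> s t s_h t_h; rewrite addrAC.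
  have [du dv duv dvu] := (near_x _ (in_ball t s t_h s_h)).1.
  exact: conj dv dvu.
rewrite [x + s2 *: v + _]addrAC [x + h *: v + _]addrAC => eq2 eq1.
have {eq1 eq2} eq12 : 'D_v ('D_u f) (x + s1 *: u + t1 *: v)
    = 'D_u ('D_v f) (x + t2 *: u + s2 *: v).
  have ACA (a b c d : R) : a - b - (c - d) = a - c - (b - d) by ring.
  have h2_neq0 : h ^+ 2 != 0 by rewrite expf_neq0 ?lt0r_neq0.
  apply: (mulfI h2_neq0); apply: etrans (esym eq1) (etrans _ eq2); exact: ACA.
have dvu := (near_x _ (in_ball s1 t1 s1_h t1_h)).2.1.
have duv := (near_x _ (in_ball t2 s2 t2_h s2_h)).2.2.
by rewrite eq12 in dvu; exact: close dvu duv.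
Qed.

Lemma partialC (R : realType) n (U : set 'rV[R]_n) (f : 'rV[R]_n -> R)
    (x : 'rV[R]_n) (i j : 'I_n) :
  open U -> smooth_on U f -> U x ->
  partial i (partial j f) x = partial j (partial i f) x.
Proof.
move=> U_open f_smooth Ux; apply: derive_comm.
- near=> y; have Uy : U y by near: y; exact: open_nbhs_nbhs.
  split; first exact: (f_smooth [::] y Uy).2.
  + exact: (f_smooth [::] y Uy).2.
  + exact: (f_smooth [:: j] y Uy).2.
  + exact: (f_smooth [:: i] y Uy).2.
- exact: (f_smooth [:: i; j] x Ux).1.
- exact: (f_smooth [:: j; i] x Ux).1.
Unshelve. all: by end_near. Qed.

(** * Differentiability of sums, determinants and inverse matrices *)

Lemma derivable_sumf (R : numFieldType) (V W : normedModType R) (I : finType)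
    (h : I -> V -> W) (x v : V) :
  (forall i, derivable (h i) x v) -> derivable (fun y => \sum_i h i y) x v.
Proof.
move=> dh; rewrite -fct_sumE.
apply: (big_ind (fun f => derivable f x v)) => [|f g|i _].
- exact: derivable_cst.
- exact: derivableD.
- exact: dh.
Qed.

Lemma derive_sumf (R : numFieldType) (V W : normedModType R) (I : finType)
    (h : I -> V -> W) (x v : V) :
  (forall i, derivable (h i) x v) ->
  'D_v (fun y => \sum_i h i y) x = \sum_i 'D_v (h i) x.
Proof.
move=> dh; rewrite -fct_sumE.
suff [] : derivable (\sum_i h i) x v /\
    'D_v (\sum_i h i) x = \sum_i 'D_v (h i) x by [].
apply: (big_ind2 (fun f d => derivable f x v /\ 'D_v f x = d)) => //.
- by split; [exact: derivable_cst|exact: derive_cst].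
- move=> f df g dg [? <-] [? <-]; split; first exact: derivableD.
  exact: deriveD.
Qed.

Lemma derivable_prodf (R : numFieldType) (V : normedModType R) (I : finType)
    (h : I -> V -> R) (x v : V) :
  (forall i, derivable (h i) x v) -> derivable (fun y => \prod_i h i y) x v.
Proof.
move=> dh; rewrite -fct_prodE.
apply: (big_ind (fun f => derivable f x v)) => [|f g|i _].
- exact: derivable_cst.
- exact: derivableM.
- exact: dh.
Qed.

Lemma derivable_det (R : numFieldType) (V : normedModType R) n
    (A : V -> 'M[R]_n) (x v : V) :
  (forall i j, derivable (fun y => A y i j) x v) ->
  derivable (fun y => \det (A y)) x v.
Proof.
move=> dA; apply: derivable_sumf => s.
apply: derivableM; first exact: derivable_cst.
by apply: derivable_prodf => i; exact: dA.
Qed.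

(** Cramer's rule writes the entry as a cofactor over the determinant. Invertibility is required
    near [x] because [invmx] returns its argument on singular matrices. *)
Lemma derivable_invmx (R : numFieldType) (V : normedModType R) n
    (A : V -> 'M[R]_n) (x v : V) (k l : 'I_n) :
  (\near x, A x \in unitmx) ->
  (forall i j, derivable (fun y => A y i j) x v) ->
  derivable (fun y => invmx (A y) k l) x v.
Proof.
move=> A_unit dA.
apply: (@near_eq_derivable _ _ _
  (fun y => (\det (A y))^-1 *
     ((-1) ^+ (l + k) * \det (row' l (col' k (A y)))))).
  by near=> y; rewrite /invmx (near A_unit y) // !mxE.
apply: derivableM.
  apply: derivableV; last exact: derivable_det.
  by have := nbhs_singleton A_unit; rewrite unitmxE unitfE.
apply: derivableM; first exact: derivable_cst.
apply: derivable_det => i j.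
by under eq_fun do rewrite !mxE; exact: dA.
Unshelve. all: by end_near. Qed.

(** * Christoffel symbols and the symmetries of the curvature tensor *)

(** A metric on a single coordinate domain, so that the curvature identities can be proved without
    reference to an atlas. *)
Record metric_on (R : realType) n (U : set 'rV[R]_n)
    (G : 'rV[R]_n -> 'M[R]_n) : Prop := MetricOn {
  metric_on_open : open U;
  metric_on_smooth : forall i j, smooth_on U (fun y => G y i j);
  metric_on_sym : forall y, U y -> (G y)^T = G y;
  metric_on_posdef : forall y, U y -> posdef (G y)
}.

(* Christoffel symbols of the first kind, Gamma_{ij,k}. *)
Definition christoffel1 (R : realType) n (G : 'rV[R]_n -> 'M[R]_n)
    (x : 'rV[R]_n) (i j k : 'I_n) : R :=
  2^-1 * (partial i (fun y => G y j k) x + partial j (fun y => G y i k) x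
          - partial k (fun y => G y i j) x).

Lemma posdef_unitmx (R : numFieldType) n (A : 'M[R]_n) :
  posdef A -> A \in unitmx.
Proof.
move=> posA; rewrite -row_free_unit -kermx_eq0.
apply/eqP/row_matrixP => i; rewrite row0; apply/eqP/negbNE/negP => ker_neq0.
have := posA _ ker_neq0; rewrite -row_mul mulmx_ker row0 mul0mx mxE ltxx.
by [].
Qed.

Lemma metric_on_symE (R : realType) n (U : set 'rV[R]_n) G (y : 'rV[R]_n)
    (i j : 'I_n) : metric_on U G -> U y -> G y i j = G y j i.
Proof. by move=> metG Uy; rewrite -[in LHS](metric_on_sym metG Uy) mxE. Qed.

Lemma metric_on_near (R : realType) n (U : set 'rV[R]_n) G (x : 'rV[R]_n) :
  metric_on U G -> U x -> \near x, U x.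
Proof.
move=> metG Ux; apply: open_nbhs_nbhs; split => //.
exact: metric_on_open metG.
Qed.

Lemma partial_metric_sym (R : realType) n (U : set 'rV[R]_n) G (x : 'rV[R]_n)
    (k i j : 'I_n) : metric_on U G -> U x ->
  partial k (fun y => G y i j) x = partial k (fun y => G y j i) x.
Proof.
move=> metG Ux; apply: near_eq_derive; near=> y.
by apply: (metric_on_symE _ _ metG); near: y; exact: metric_on_near metG Ux.
Unshelve. all: by end_near. Qed.

Lemma derivable_metric (R : realType) n (U : set 'rV[R]_n) G (x : 'rV[R]_n)
    (k i j : 'I_n) : metric_on U G -> U x ->
  derivable (fun y => G y i j) x (delta_mx 0 k).
Proof. by move=> metG Ux; exact: (metric_on_smooth metG i j [::] Ux).2. Qed.

Lemma derivable_partial_metric (R : realType) n (U : set 'rV[R]_n) G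
    (x : 'rV[R]_n) (k l i j : 'I_n) : metric_on U G -> U x ->
  derivable (partial l (fun y => G y i j)) x (delta_mx 0 k).
Proof. by move=> metG Ux; exact: (metric_on_smooth metG i j [:: l] Ux).2. Qed.

Lemma derivable_christoffel1 (R : realType) n (U : set 'rV[R]_n) G
    (x : 'rV[R]_n) (a i j k : 'I_n) : metric_on U G -> U x ->
  derivable (fun y => christoffel1 G y i j k) x (delta_mx 0 a).
Proof.
move=> metG Ux; apply: derivableM; first exact: derivable_cst.
apply: derivableB; last exact: derivable_partial_metric metG Ux.
by apply: derivableD; exact: derivable_partial_metric metG Ux.
Qed.

Lemma partial_christoffel1 (R : realType) n (U : set 'rV[R]_n) G
    (x : 'rV[R]_n) (a i j k : 'I_n) : metric_on U G -> U x ->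
  partial a (fun y => christoffel1 G y i j k) x =
  2^-1 * (partial a (partial i (fun y => G y j k)) x
          + partial a (partial j (fun y => G y i k)) x
          - partial a (partial k (fun y => G y i j)) x).
Proof.
move=> metG Ux.
have dG l i' j' := @derivable_partial_metric _ _ _ _ _ a l i' j' metG Ux.
rewrite {1}/partial /christoffel1 deriveM; last 2 first.
- exact: derivable_cst.
- by apply: derivableB => //; exact: derivableD.
rewrite derive_cst scaler0 addr0; congr (_ * _).
rewrite deriveB; [|exact: derivableD|by []].
by rewrite deriveD.
Qed.

Lemma christoffelE (R : realType) n G (x : 'rV[R]_n) (k i j : 'I_n) :
  christoffel G x k i j = \sum_l ginv G x k l * christoffel1 G x i j l.
Proof.
rewrite /christoffel mulr_sumr; apply: eq_bigr => l _.
by rewrite /christoffel1; ring.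
Qed.

Lemma metric_christoffel (R : realType) n (U : set 'rV[R]_n) G (x : 'rV[R]_n)
    (k i j : 'I_n) : metric_on U G -> U x ->
  \sum_m G x k m * christoffel G x m i j = christoffel1 G x i j k.
Proof.
move=> metG Ux.
pose C : 'cV[R]_n := \col_l christoffel1 G x i j l.
have GC := mulKVmx (posdef_unitmx (metric_on_posdef metG Ux)) C.
have -> : christoffel1 G x i j k = C k 0 by rewrite mxE.
rewrite -GC mxE; apply: eq_bigr => m _.
by rewrite christoffelE mxE; congr (_ * _); apply: eq_bigr => l _; rewrite mxE.
Qed.

Lemma derivable_christoffel (R : realType) n (U : set 'rV[R]_n) G
    (x : 'rV[R]_n) (a k i j : 'I_n) : metric_on U G -> U x ->
  derivable (fun y => christoffel G y k i j) x (delta_mx 0 a).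
Proof.
move=> metG Ux; under eq_fun do rewrite christoffelE.
apply: derivable_sumf => l; apply: derivableM; last first.
  exact: derivable_christoffel1 metG Ux.
apply: derivable_invmx => [|i' j']; last exact: derivable_metric metG Ux.
near=> y; apply: posdef_unitmx; apply: (metric_on_posdef metG).
by near: y; exact: metric_on_near metG Ux.
Unshelve. all: by end_near. Qed.

(** The coordinate form of the parallelism of the metric. *)
Lemma metric_compatible (R : realType) n (U : set 'rV[R]_n) G (x : 'rV[R]_n)
    (k i j : 'I_n) : metric_on U G -> U x ->
  partial k (fun y => G y i j) x
    = christoffel1 G x k i j + christoffel1 G x k j i.
Proof.
move=> metG Ux; rewrite /christoffel1.
rewrite (partial_metric_sym k j i metG Ux); lra.
Qed.

(** Differentiating the lowered identity [metric_christoffel] by the product rule avoids computing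
    the derivative of the inverse metric. *)
Lemma metric_partial_christoffel (R : realType) n (U : set 'rV[R]_n) G
    (x : 'rV[R]_n) (a k i j : 'I_n) : metric_on U G -> U x ->
  \sum_m G x k m * partial a (fun y => christoffel G y m i j) x =
  partial a (fun y => christoffel1 G y i j k) x
  - \sum_m (christoffel1 G x a k m + christoffel1 G x a m k)
      * christoffel G x m i j.
Proof.
move=> metG Ux.
have -> : partial a (fun y => christoffel1 G y i j k) x
    = partial a (fun y => \sum_m G y k m * christoffel G y m i j) x.
  apply: near_eq_derive; near=> y; apply/esym/(metric_christoffel _ _ _ metG).
  by near: y; exact: metric_on_near metG Ux.
rewrite [in RHS]/partial derive_sumf => [|m]; last first.
  apply: derivableM; first exact: derivable_metric metG Ux.
  exact: derivable_christoffel metG Ux.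
rewrite -sumrB; apply: eq_bigr => m _.
rewrite deriveM; [|exact: derivable_metric metG Ux
  |exact: derivable_christoffel metG Ux].
rewrite -(metric_compatible _ _ _ metG Ux) /partial.
by rewrite [christoffel _ _ _ _ _ *: _]mulrC addrK.
Unshelve. all: by end_near. Qed.

(** Of the products created by lowering the index under the derivative, one half cancels the
    quadratic part of [riem_endo]; the other half remains. *)
Lemma Rm_christoffel1 (R : realType) n (U : set 'rV[R]_n) G (x : 'rV[R]_n)
    (i j k l : 'I_n) : metric_on U G -> U x ->
  Rm G x i j k l =
    partial i (fun y => christoffel1 G y j l k) x
    - partial j (fun y => christoffel1 G y i l k) x
    - \sum_m christoffel1 G x i k m * christoffel G x m j l
    + \sum_m christoffel1 G x j k m * christoffel G x m i l.
Proof.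
move=> metG Ux; rewrite /Rm /riem_endo.
have split3 (a b c d : 'I_n -> R) :
    \sum_m a m * (b m - c m + d m)
    = \sum_m a m * b m - \sum_m a m * c m + \sum_m a m * d m.
  rewrite -sumrB -big_split; apply: eq_bigr => m _ /=.
  by rewrite mulrDr mulrBr.
pose quadr m := \sum_p (christoffel G x p j l * christoffel G x m i p
                       - christoffel G x p i l * christoffel G x m j p).
have quad i' j' :
    \sum_m G x k m * \sum_p christoffel G x p j' l * christoffel G x m i' p
    = \sum_p christoffel1 G x i' p k * christoffel G x p j' l.
  under eq_bigr do rewrite mulr_sumr.
  rewrite exchange_big; apply: eq_bigr => p _ /=.
  rewrite -(metric_christoffel _ _ _ metG Ux) mulr_suml.
  by apply: eq_bigr => m _; ring.
have quadrE : \sum_m G x k m * quadr m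
    = \sum_p christoffel1 G x i p k * christoffel G x p j l
      - \sum_p christoffel1 G x j p k * christoffel G x p i l.
  rewrite -(quad i j) -(quad j i) -sumrB; apply: eq_bigr => m _.
  by rewrite /quadr sumrB mulrBr.
have distr a b :
    \sum_m (christoffel1 G x a k m + christoffel1 G x a m k)
      * christoffel G x m b l
    = \sum_m christoffel1 G x a k m * christoffel G x m b l
      + \sum_m christoffel1 G x a m k * christoffel G x m b l.
  by rewrite -big_split; apply: eq_bigr => m _; rewrite mulrDl.
have combine (A B C a b S T p p' q q' : R) : A = a - S -> B = b - T ->
    C = p' - q' -> S = p + p' -> T = q + q' -> A - B + C = a - b - p + q.
  by move=> -> -> -> -> ->; ring.
apply: etrans (combine _ _ _ _ _ _ _ _ _ _ _
  (metric_partial_christoffel i k j l metG Ux)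
  (metric_partial_christoffel j k i l metG Ux) quadrE (distr i j) (distr j i)).
exact: (split3 (G x k) (fun m => partial i (fun y => christoffel G y m j l) x)
  (fun m => partial j (fun y => christoffel G y m i l) x) quadr).
Qed.

(** Both sides contract two symbols of the first kind with the inverse metric, which is
    symmetric. *)
Lemma christoffel_pairC (R : realType) n (U : set 'rV[R]_n) G (x : 'rV[R]_n)
    (i j k l : 'I_n) : metric_on U G -> U x ->
  \sum_m christoffel1 G x i j m * christoffel G x m k l =
  \sum_m christoffel1 G x k l m * christoffel G x m i j.
Proof.
move=> metG Ux.
under eq_bigr do rewrite christoffelE mulr_sumr.
under [RHS]eq_bigr do rewrite christoffelE mulr_sumr.
rewrite exchange_big; apply: eq_bigr => p _; apply: eq_bigr => m _ /=.
have -> : ginv G x m p = ginv G x p m.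
  by rewrite /ginv -[in LHS](metric_on_sym metG Ux) -trmx_inv mxE.
ring.
Qed.

Lemma christoffel1C (R : realType) n (U : set 'rV[R]_n) G (x : 'rV[R]_n)
    (i j k : 'I_n) : metric_on U G -> U x ->
  christoffel1 G x i j k = christoffel1 G x j i k.
Proof.
move=> metG Ux; rewrite /christoffel1 (partial_metric_sym k i j metG Ux); ring.
Qed.

(** The classical expression by second derivatives of the metric, from which the symmetries of [Rm]
    can be read off. The two derivatives of [G y l k] cancel since partial derivatives commute. *)
Lemma RmE (R : realType) n (U : set 'rV[R]_n) G (x : 'rV[R]_n)
    (i j k l : 'I_n) : metric_on U G -> U x ->
  let d2 a b p q := partial a (partial b (fun y => G y p q)) x in
  let Q a b p q := \sum_m christoffel1 G x a b m * christoffel G x m p q in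
  Rm G x i j k l =
    2^-1 * (d2 i l j k - d2 i k j l - d2 j l i k + d2 j k i l)
    - Q i k j l + Q j k i l.
Proof.
move=> metG Ux d2 Q.
have d2C : d2 i j l k = d2 j i l k.
  by apply: partialC Ux; [exact: metric_on_open metG|exact: metric_on_smooth].
have combine (r A B q q' x0 y0 a b c d : R) : r = A - B - q + q' ->
    A = 2^-1 * (x0 + a - b) -> B = 2^-1 * (y0 + c - d) -> x0 = y0 ->
    r = 2^-1 * (a - b - c + d) - q + q'.
  by move=> -> -> -> ->; ring.
exact: combine (Rm_christoffel1 i j k l metG Ux)
  (partial_christoffel1 i j l k metG Ux)
  (partial_christoffel1 j i l k metG Ux) d2C.
Qed.

Lemma Rm_antisymr (R : realType) n (U : set 'rV[R]_n) G (x : 'rV[R]_n)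
    (i j k l : 'I_n) : metric_on U G -> U x ->
  Rm G x i j l k = - Rm G x i j k l.
Proof.
move=> metG Ux.
have combine (r r' a b c d q1 q2 q3 q4 : R) :
    r = 2^-1 * (b - a - d + c) - q1 + q2 ->
    r' = 2^-1 * (a - b - c + d) - q3 + q4 -> q1 = q4 -> q2 = q3 -> r = - r'.
  by move=> -> -> -> ->; ring.
exact: combine (RmE i j l k metG Ux) (RmE i j k l metG Ux)
  (christoffel_pairC i l j k metG Ux) (christoffel_pairC j l i k metG Ux).
Qed.

(** Exchanging the pairs in [RmE] matches each second derivative with one where the differentiation
    indices and the metric indices are both swapped. The quadratic terms match because the
    Christoffel symbols are symmetric in their lower indices. *)
Lemma Rm_pairC (R : realType) n (U : set 'rV[R]_n) G (x : 'rV[R]_n)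
    (i j k l : 'I_n) : metric_on U G -> U x ->
  Rm G x k l i j = Rm G x i j k l.
Proof.
move=> metG Ux.
have d2CS a b p q : partial a (partial b (fun y => G y p q)) x
    = partial b (partial a (fun y => G y q p)) x.
  have -> : partial a (partial b (fun y => G y p q)) x
      = partial b (partial a (fun y => G y p q)) x.
    by apply: partialC Ux; [exact: metric_on_open metG|exact: metric_on_smooth].
  apply: near_eq_derive; near=> y; apply: (partial_metric_sym _ _ _ metG).
  by near: y; exact: metric_on_near metG Ux.
have QC a b p q : \sum_m christoffel1 G x a b m * christoffel G x m p q
    = \sum_m christoffel1 G x b a m * christoffel G x m q p.
  apply: eq_bigr => m _; rewrite (christoffel1C a b m metG Ux); congr (_ * _).
  rewrite !christoffelE; apply: eq_bigr => r _.
  by rewrite (christoffel1C p q r metG Ux).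
have combine (r r' a a' b b' c c' d d' q1 q1' q2 q2' : R) :
    r = 2^-1 * (a - b - c + d) - q1 + q2 ->
    r' = 2^-1 * (d' - b' - c' + a') - q1' + q2' ->
    a = a' -> b = b' -> c = c' -> d = d' -> q1 = q1' -> q2 = q2' -> r = r'.
  by move=> -> -> -> -> -> -> -> ->; ring.
exact: combine (RmE k l i j metG Ux) (RmE i j k l metG Ux)
  (d2CS k j l i) (d2CS k i l j) (d2CS l j k i) (d2CS l i k j)
  (QC k i l j) (etrans (QC l i k j) (christoffel_pairC i l j k metG Ux)).
Unshelve. all: by end_near. Qed.

(** * Curvature tensors as bilinear forms on matrices *)

(** The factor 1/2 and the raised indices of [curvature_operator] are left out, so that pair
    symmetry of [T] becomes symmetry of a matrix. *)
Definition tensor4_apply (R : comPzRingType) n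
    (T : 'I_n -> 'I_n -> 'I_n -> 'I_n -> R) (xi : 'M[R]_n) :
    'M[R]_n :=
  \matrix_(a, b) \sum_i \sum_j T i j a b * xi i j.

Lemma tensor4_apply_linear (R : comPzRingType) n
    (T : 'I_n -> 'I_n -> 'I_n -> 'I_n -> R) : linear (tensor4_apply T).
Proof.
move=> c xi eta; apply/matrixP => a b; rewrite !mxE mulr_sumr -big_split.
apply: eq_bigr => i _ /=; rewrite mulr_sumr -big_split.
by apply: eq_bigr => j _ /=; rewrite !mxE mulrDr mulrCA.
Qed.

HB.instance Definition _ (R : comPzRingType) n
    (T : 'I_n -> 'I_n -> 'I_n -> 'I_n -> R) :=
  GRing.isLinear.Build R 'M[R]_n 'M[R]_n _ (tensor4_apply T)
    (tensor4_apply_linear T).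

Lemma lin_mxE (R : comPzRingType) m1 n1 m2 n2
    (f : 'M[R]_(m1, n1) -> 'M[R]_(m2, n2)) i j k l :
  lin_mx f (mxvec_index i j) (mxvec_index k l) = f (delta_mx i j) k l.
Proof. by rewrite mxE /= mxvecE vec_mx_delta. Qed.

Lemma mxvec_dot (R : comPzRingType) m n (xi eta : 'M[R]_(m, n)) :
  (mxvec xi *m (mxvec eta)^T) 0 0 = \sum_i \sum_j xi i j * eta i j.
Proof.
rewrite mxE (reindex _ (curry_mxvec_bij _ _)) /= pair_bigA /=.
by apply: eq_bigr => [[i j]] _; rewrite !mxE !mxvecE.
Qed.

(** The map from [xi] to [G *m xi *m G] represents the metric induced on 2-tensors, twice
    [bivector_inner]; it serves as [B] in [negative_generalized_eigenvalue]. *)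
Lemma lin_mx_mul_sym (R : comPzRingType) n (G : 'M[R]_n) :
  G^T = G -> (lin_mx (mulmxr G \o mulmx G))^T = lin_mx (mulmxr G \o mulmx G).
Proof.
move=> symG.
have entry i j k l : (G *m delta_mx i j *m G) k l = G k i * G j l.
  rewrite -(mul_delta_mx (0 : 'I_1)) mulmxA -mulmxA mxE big_ord1.
  by rewrite -rowE -colE !mxE.
have GC i j : G i j = G j i by rewrite -[in LHS]symG mxE.
apply/matrixP => p q; rewrite mxE.
case/mxvec_indexP: p => i j; case/mxvec_indexP: q => k l.
by rewrite !lin_mxE /= !entry (GC i k) (GC l j).
Qed.

(** With [G = P *m P^T], the form at [xi] is the sum of the squared entries of [P^T *m xi *m P], and
    [P] is invertible. *)
Lemma lin_mx_mul_posdef (R : rcfType) n (G : 'M[R]_n) :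
  G^T = G -> posdef G -> posdef (lin_mx (mulmxr G \o mulmx G)).
Proof.
move=> symG posG v; rewrite -(vec_mxK v); move: (vec_mx v) => xi xi_neq0.
have [P defG] := cholesky symG posG.
have G_unit := posdef_unitmx posG.
have P_unit : P \in unitmx.
  by move: G_unit; rewrite defG unitmx_mul => /andP[].
have -> : (mxvec xi *m lin_mx (mulmxr G \o mulmx G) *m (mxvec xi)^T) 0 0
    = (mxvec (P^T *m xi *m P) *m (mxvec (P^T *m xi *m P))^T) 0 0.
  have trE (u w : 'M[R]_n) : (mxvec u *m (mxvec w)^T) 0 0 = \tr (u *m w^T).
    rewrite mxvec_dot /mxtrace; apply: eq_bigr => i _; rewrite mxE.
    by apply: eq_bigr => j _; rewrite mxE.
  rewrite mul_vec_lin /= !trE defG !trmx_mul trmxK -!mulmxA mxtrace_mulC.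
  by rewrite !mulmxA.
rewrite lt_def mulmx_trmx_row_ge0 andbT mulmx_trmx_row_eq0.
apply: contra_neq xi_neq0 => /(congr1 vec_mx); rewrite mxvecK linear0 => PxiP0.
have : invmx P^T *m (P^T *m xi *m P) *m invmx P = xi.
  by rewrite -!mulmxA mulmxV // mulmx1 mulKmx // unitmx_tr.
by rewrite PxiP0 mulmx0 mul0mx => <-; rewrite linear0.
Qed.

(* The matrices of all bilinear forms are taken on the full space 'M_n rather
   than on bivectors: T takes antisymmetric values, so an eigenvector for a
   nonzero eigenvalue is automatically a bivector. *)
Lemma curvature_tensor_eq0 (R : realType) n (G : 'M[R]_n)
    (T : 'I_n -> 'I_n -> 'I_n -> 'I_n -> R) :
  G^T = G -> posdef G ->
  (forall i j k l, T i j l k = - T i j k l) ->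
  (forall i j k l, T k l i j = T i j k l) ->
  (forall j, \sum_i \sum_k invmx G i k * T i j k j = 0) ->
  (forall (lambda : R) (xi : 'M[R]_n), is_bivector xi -> xi != 0 ->
    2^-1 *: (invmx G *m tensor4_apply T xi *m (invmx G)^T) = lambda *: xi ->
    0 <= lambda) ->
  forall i j k l, T i j k l = 0.
Proof.
move=> symG posG T_antisym T_pairC ric0 nonneg.
have G_unit := posdef_unitmx posG.
have symVG : (invmx G)^T = invmx G by rewrite trmx_inv symG.
pose A := lin_mx (tensor4_apply T); pose B := lin_mx (mulmxr G \o mulmx G).
have symA : A^T = A.
  apply/matrixP => p q; rewrite mxE.
  case/mxvec_indexP: p => i j; case/mxvec_indexP: q => k l.
  have entry i' j' k' l' :
      tensor4_apply T (delta_mx i' j') k' l' = T i' j' k' l'.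
    rewrite mxE (bigD1 i') //= (bigD1 j') //= mxE !eqxx mulr1.
    rewrite big1 => [|j2 /negbTE j2_neq]; last first.
      by rewrite mxE j2_neq andbF mulr0.
    rewrite big1 ?addr0 // => i2 /negbTE i2_neq.
    by rewrite big1 // => j2 _; rewrite mxE i2_neq mulr0.
  by rewrite !lin_mxE !entry T_pairC.
(* A negative value would give [xi] with [T xi = lambda *: (G *m xi *m G)] and [lambda < 0]; raising
   the indices turns it into an eigenvector of the curvature operator for [lambda / 2]. *)
have psdA (v : 'rV[R]_(n * n)) : 0 <= (v *m A *m v^T) 0 0.
  rewrite leNgt; apply/negP => neg.
  have [lambda [w [lambda_lt0 w_neq0 wA]]] := negative_generalized_eigenvalue
    symA (lin_mx_mul_sym symG) (lin_mx_mul_posdef symG posG) neg.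
  pose xi : 'M[R]_n := vec_mx w.
  have xi_neq0 : xi != 0.
    by apply: contra_neq w_neq0 => xi0; rewrite -(vec_mxK w) -/xi xi0 linear0.
  have Txi : tensor4_apply T xi = lambda *: (G *m xi *m G).
    have := congr1 vec_mx wA; rewrite linearZ /= !mul_rV_lin !mxvecK.
    exact.
  have xi_bivector : is_bivector xi.
    have xiE : lambda *: xi = invmx G *m tensor4_apply T xi *m invmx G.
      by rewrite Txi -scalemxAr -scalemxAl -!mulmxA mulmxV // mulmx1 mulKmx.
    have Txi_antisym : (tensor4_apply T xi)^T = - tensor4_apply T xi.
      apply/matrixP => a b; rewrite !mxE -sumrN; apply: eq_bigr => i _.
      by rewrite -sumrN; apply: eq_bigr => j _; rewrite T_antisym mulNr.
    apply: (scalerI (ltr0_neq0 lambda_lt0)); rewrite scalerN -linearZ /= xiE.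
    by rewrite !trmx_mul symVG Txi_antisym mulNmx mulmxN mulmxA.
  suff : 0 <= 2^-1 * lambda by rewrite leNgt pmulr_rlt0 ?lambda_lt0 ?invr_gt0.
  apply: nonneg xi_bivector xi_neq0 _.
  rewrite Txi symVG -scalemxAr -scalemxAl -!mulmxA mulmxV // mulmx1 mulKmx //.
  by rewrite scalerA.
have [P defG] := cholesky symG posG.
have P_unit : P \in unitmx.
  by move: G_unit; rewrite defG unitmx_mul => /andP[].
(* The columns of [E] form an orthonormal basis for [G], since [E^T *m G *m E = 1]. *)
pose E : 'M[R]_n := invmx P^T.
have E_unit : E \in unitmx by rewrite unitmx_inv unitmx_tr.
have VGE : invmx G = E *m E^T.
  apply: (can_inj (mulKmx G_unit)); rewrite mulmxV // defG /E trmx_inv trmxK.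
  by rewrite -!mulmxA (mulmxA P^T) mulmxV ?unitmx_tr // mul1mx mulmxV.
(* This is the tensor product of the [m]-th orthonormal vector with the [j]-th coordinate vector. It
   is not antisymmetrized: [T] only sees its antisymmetric part. *)
pose xi m j : 'M[R]_n := col m E *m delta_mx 0 j.
have xiE m j i' j' : xi m j i' j' = E i' m * (j' == j)%:R.
  by rewrite mxE big_ord1 !mxE.
have TxiE m j a b : tensor4_apply T (xi m j) a b = \sum_i T i j a b * E i m.
  rewrite mxE; apply: eq_bigr => i _; rewrite (bigD1 j) //= xiE eqxx mulr1.
  rewrite big1 ?addr0 // => j' /negbTE j'_neq.
  by rewrite xiE j'_neq !mulr0.
pose q m j := (mxvec (xi m j) *m A *m (mxvec (xi m j))^T) 0 0.
have qE m j : q m j = \sum_i \sum_k E i m * E k m * T i j k j.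
  rewrite /q mul_vec_lin mxvec_dot exchange_big /=.
  rewrite (bigD1 j) //= [X in _ + X]big1 ?addr0 => [|j' /negbTE j'_neq].
    rewrite exchange_big /=; apply: eq_bigr => k _.
    rewrite TxiE xiE eqxx mulr1 mulr_suml; apply: eq_bigr => i _; ring.
  by rewrite big1 // => k _; rewrite xiE j'_neq !mulr0.
(* The sum over [m] is the Ricci contraction at [j], which is zero, and every term is
   nonnegative. *)
have q0 m j : q m j = 0.
  have : \sum_m q m j = 0.
    rewrite -[RHS](ric0 j) VGE; under eq_bigr do rewrite qE.
    rewrite exchange_big; apply: eq_bigr => i _ /=.
    rewrite exchange_big; apply: eq_bigr => k _ /=.
    by rewrite mxE mulr_suml; apply: eq_bigr => m' _; rewrite mxE.
  move/eqP; rewrite psumr_eq0 => [/allP q_eq0|m' _]; last exact: psdA.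
  by have /eqP := q_eq0 m (mem_index_enum _).
move=> i j k l.
(* The entries of [t *m E] are the values of [T] on [xi m j], zero because [xi m j] lies in the
   kernel of the form; [E] is invertible, so [t] vanishes. *)
pose t : 'rV[R]_n := \row_i' T i' j k l.
suff t0 : t = 0 by have := congr1 (fun v : 'rV[R]_n => v 0 i) t0; rewrite !mxE.
apply: (can_inj (mulmxK E_unit)); rewrite mul0mx; apply/rowP => m.
have := psd_isotropic_ker symA psdA (q0 m j).
rewrite mul_vec_lin => /(congr1 vec_mx); rewrite mxvecK linear0.
move=> /(congr1 (fun X : 'M[R]_n => X k l)); rewrite TxiE !mxE => tE0.
by rewrite -[RHS]tE0; apply: eq_bigr => i' _; rewrite mxE.
Qed.

(** * Flatness of the manifold and vanishing of the Weyl part *)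

Lemma gram_metric_on (R : realType) n (M : smooth_manifold R n)
    (g : riemannian_metric M) (a : chart_index M) :
  metric_on (img (atlas a)) (gram g a).
Proof.
split; first exact: img_open.
- exact: gram_smooth.
- exact: gram_sym.
- exact: gram_posdef.
Qed.

Lemma curvature_operatorE (R : realType) n (G : 'rV[R]_n -> 'M[R]_n)
    (x : 'rV[R]_n) (xi : 'M[R]_n) :
  curvature_operator G x xi
  = 2^-1 *: (invmx (G x) *m tensor4_apply (Rm G x) xi *m (invmx (G x))^T).
Proof.
apply/matrixP => k l; rewrite !mxE; congr (_ * _).
have exchange3 (F : 'I_n -> 'I_n -> 'I_n -> R) :
    \sum_i \sum_j \sum_a F i j a = \sum_a \sum_i \sum_j F i j a.
  by under eq_bigr do rewrite exchange_big /=; exact: exchange_big.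
rewrite exchange3 [RHS](eq_bigr (fun b => \sum_a \sum_i \sum_j
  ginv G x k a * ginv G x l b * Rm G x i j a b * xi i j)) => [|b _].
  by rewrite [RHS]exchange_big; apply: eq_bigr => a _; exact: exchange3.
rewrite !mxE mulr_suml; apply: eq_bigr => a _.
rewrite mxE mulr_sumr mulr_suml; apply: eq_bigr => i _.
rewrite mulr_sumr mulr_suml; apply: eq_bigr => j _.
by rewrite /ginv; ring.
Qed.

Lemma ricci_flat_nonneg_flat (R : realType) n (M : smooth_manifold R n)
    (g : riemannian_metric M) :
  ricci_flat g -> curvature_operator_1nonneg g -> flat g.
Proof.
move=> ric0 nonneg a x x_img; have metG := gram_metric_on g a.
apply: (curvature_tensor_eq0 (metric_on_sym metG x_img)
  (metric_on_posdef metG x_img)).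
- by move=> i j k l; exact: Rm_antisymr metG x_img.
- by move=> i j k l; exact: Rm_pairC metG x_img.
- by move=> j; exact: ric0.
- move=> lambda xi xi_bivector xi_neq0; rewrite -curvature_operatorE.
  exact: nonneg.
Qed.

Theorem proposition6p1 (R : realType) (M : smooth_manifold R 4)
    (g : riemannian_metric M) (c : R) (s : bool) :
  let Wpart : tensor_field M 4 := fun a => Weyl_part s (gram g a) in
  complete g -> oriented M -> ricci_flat g -> ALE g ->
  0 < c ->
  vanishes (fun a => lichnerowicz c (gram g a) (Wpart a)) ->
  (exists Q : R, 1 < Q /\ in_LQ g Q (tensor_norm g Wpart)) ->
  curvature_operator_1nonneg g ->
  vanishes Wpart /\ flat g.
Proof.
move=> Wpart _ _ ric0 _ _ _ _ nonneg.
have flat_g := ricci_flat_nonneg_flat ric0 nonneg.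
split=> // a x x_img I.
have W0 i j k l : Weyl (gram g a) x i j k l = 0.
  have scal0 : scal (gram g a) x = 0.
    rewrite /scal big1 // => i' _; rewrite big1 // => j' _.
    by rewrite ric0 // mulr0.
  by rewrite /Weyl flat_g // scal0 !ric0 //; ring.
rewrite /Wpart /Weyl_part W0 /hodge_star.
(* Every term of the four nested sums in [hodge_star] contains a component of the Weyl tensor. *)
rewrite big1 ?mulr0 ?addr0 ?mulr0 // => p _.
by do 3![rewrite big1 // => ? _]; rewrite W0 mulr0 mul0r.
Qed.
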